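(* Let $n\geq 3$ be an integer, let $q_n=x_1^2+\cdots+x_n^2$, $T_{n,2}=\binom{n+1}{2}$ and $B_{n,2}=\frac{2(n+2)}{3(n+1)}$. Suppose there are points $\mathbf{a}_1,\dots,\mathbf{a}_{T_{n,2}}\in\mathbb{C}^n$ with $$\frac{1}{B_{n,2}}\,q_n^2=\sum_{j=1}^{T_{n,2}}(\mathbf{a}_j\cdot\mathbf{x})^4$$ (that is, up to the scalar factor, a tight decomposition of $q_n^2$). Then $n=3$ or $n=m^2-2$ for some odd number $m\in\mathbb{N}$.
   Context: Here $\mathbf{a}\cdot\mathbf{x}=a_1x_1+\cdots+a_nx_n$ for $\mathbf{a}=(a_1,\dots,a_n)\in\mathbb{C}^n$, and the identity is in $\mathbb{C}[x_1,\dots,x_n]$. A decomposition of (a scalar multiple of) $q_n^2$ as a sum of fourth powers of complex linear forms is called tight if its number of summands is $T_{n,2}$. *)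

(* Defs.v *)
From mathcomp Require Import all_boot all_order all_algebra.
From mathcomp Require Import reals.
From mathcomp Require Import complex.
From mathcomp Require Import mpoly.

Set Implicit Arguments.
Unset Strict Implicit.
Unset Printing Implicit Defensive.

Import GRing.Theory.

Local Open Scope ring_scope.

Definition q (K : comNzRingType) (n : nat) : {mpoly K[n]} :=
  \sum_(i < n) 'X_i ^+ 2.

Definition linear_form (K : comNzRingType) (n : nat) (a : 'rV[K]_n) :
    {mpoly K[n]} :=
  \sum_(i < n) a ord0 i *: 'X_i.

Definition T2 (n : nat) : nat := 'C(n + 1, 2).

Definition B2 (K : fieldType) (n : nat) : K :=
  (2 * (n + 2))%N%:R / (3 * (n + 1))%N%:R.

(* Main.v *)
Require Import Defs.
From mathcomp Require Import all_boot all_order all_algebra.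
From mathcomp Require Import reals.
From mathcomp Require Import complex.
From mathcomp Require Import mpoly.
From mathcomp Require Import ring zify.

(** Write $x \cdot y$ for the bilinear form [dot]. The proof has two halves.

    From the decomposition to equiangular lines. Polarizing the quartic
    identity gives all the fourth moments of the points $a_j$, and contracting
    these gives the second and zeroth moments with weights $a_j \cdot a_j$. The
    forms $(a_j \cdot x)^2$ span the space of quadratic forms, and there are as
    many of them as its dimension, so they are a basis; the moments give the
    dual basis, and duality says that the matrix with entries
    $((n+2)(a_i \cdot a_j)^2 - (a_i \cdot a_i)(a_j \cdot a_j)) / (n+1)$
    is the identity. This can be seen without the space of quadratic forms: it
    is idempotent by the moment identities, and its trace is its size, so it is
    the identity ([tight_gram_sq]). Hence $(a_j \cdot a_j)^2 = 1$. Multiplying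
    by the imaginary unit those points with $a_j \cdot a_j = -1$, which leaves
    their fourth powers unchanged, one may assume $a_j \cdot a_j = 1$, and then
    $(a_i \cdot a_j)^2 = 1/(n+2)$ off the diagonal: although the points are
    complex, their Gram matrix is real.

    From equiangular lines to arithmetic. Put $s_{ij} = \sqrt{n+2}\,
    a_i \cdot a_j$, a sign for $i \ne j$. The second moments say that for
    $i \ne j$ the sum $z = \sum_k s_{ij} s_{ik} s_{jk}$ over $k \ne i, j$ is
    $\sqrt{n+2}\,(n-3)/2$ ([tight_sign_matrix]). It is an integer, so for
    $n \ne 3$ the number $n + 2$ is a square $m^2$. The signs form a regular
    two-graph, that is, each pair of vertices lies in the same number of triples
    with product $-1$. A count modulo 4 shows that unless all triples have the
    same sign the number of vertices is even ([regular_two_graph_even]). Here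
    the exceptional case would need $|z| = \binom{n+1}{2} - 2$, which is too
    large; and $\binom{n+1}{2}$ is odd when $m$ is even. So $m$ is odd. *)

Set Implicit Arguments.
Unset Strict Implicit.
Unset Printing Implicit Defensive.

Import Order.TTheory GRing.Theory Num.Theory.

Local Open Scope ring_scope.

(** * Idempotent matrices *)

(** In a factorization $P = CD$ through the rank, $P^2 = P$ forces $DC = 1$,
    and the trace of $CD$ is the trace of $DC$. *)
Lemma mxtrace_idempotent (F : fieldType) (N : nat) (P : 'M[F]_N) :
  P *m P = P -> \tr P = (\rank P)%:R.
Proof.
move=> PP; have CR := mulmx_base P.
have RC : row_base P *m col_base P = 1%:M.
  have := (row_base_free P, col_base_full P).
  move: (col_base P) (row_base P) CR => C D CD [freeD fullC].
  apply: (row_free_inj freeD); apply: (row_full_inj fullC).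
  by rewrite mul1mx mulmxA mulmxA CD -mulmxA CD PP.
by rewrite -CR mxtrace_mulC RC mxtrace1 CR.
Qed.

(** The complementary idempotent $1 - P$ has trace, hence rank, zero; this uses
    characteristic zero. *)
Lemma idempotent_full_trace (F : numFieldType) (N : nat) (P : 'M[F]_N) :
  P *m P = P -> \tr P = N%:R -> P = 1%:M.
Proof.
move=> PP trP; apply/esym/eqP; rewrite -subr_eq0 -mxrank_eq0 -(eqr_nat F).
rewrite -mxtrace_idempotent ?mulmxBl ?mulmxBr ?mulmx1 ?mul1mx ?PP ?subrr ?subr0 //.
by rewrite raddfB /= mxtrace1 trP subrr.
Qed.

(** * The bilinear form and evaluation of the quartic identity *)

Definition dot (K : comNzRingType) (n : nat) (x y : 'rV[K]_n) : K :=
  (x *m y^T) ord0 ord0.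

Definition stdvec (K : comNzRingType) (n : nat) (k : 'I_n) : 'rV[K]_n :=
  delta_mx ord0 k.

Section Dot.
Variables (K : comNzRingType) (n : nat).
Implicit Types x y z : 'rV[K]_n.

Lemma dotE x y : dot x y = \sum_(k < n) x ord0 k * y ord0 k.
Proof. by rewrite /dot mxE; apply: eq_bigr => k _; rewrite mxE. Qed.

Lemma dotC x y : dot x y = dot y x.
Proof. by rewrite !dotE; apply: eq_bigr => k _; rewrite mulrC. Qed.

Lemma dotDr x y z : dot x (y + z) = dot x y + dot x z.
Proof. by rewrite /dot linearD mulmxDr mxE. Qed.

Lemma dotDl x y z : dot (x + y) z = dot x z + dot y z.
Proof. by rewrite dotC dotDr !(dotC z). Qed.

Lemma dotNr x y : dot x (- y) = - dot x y.
Proof. by rewrite /dot linearN mulmxN mxE. Qed.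

Lemma dotNl x y : dot (- x) y = - dot x y.
Proof. by rewrite dotC dotNr dotC. Qed.

Lemma dotZl c x y : dot (c *: x) y = c * dot x y.
Proof. by rewrite /dot -scalemxAl mxE. Qed.

Lemma dotZr c x y : dot x (c *: y) = c * dot x y.
Proof. by rewrite dotC dotZl dotC. Qed.

Lemma dot_delta x k : dot x (stdvec K k) = x ord0 k.
Proof.
rewrite dotE (bigD1 k) //= /stdvec mxE !eqxx mulr1 big1 ?addr0 // => l lk.
by rewrite mxE (negPf lk) andbF mulr0.
Qed.

Lemma dot_parseval x y :
  \sum_(k < n) dot x (stdvec K k) * dot y (stdvec K k) = dot x y.
Proof. by rewrite dotE; apply: eq_bigr => k _; rewrite !dot_delta. Qed.

Lemma meval_linear_form (a x : 'rV[K]_n) :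
  (linear_form a).@[x ord0] = dot a x.
Proof.
rewrite /linear_form dotE raddf_sum; apply: eq_bigr => k _ /=.
by rewrite mevalZ mevalXU.
Qed.

Lemma meval_q (x : 'rV[K]_n) : (q K n).@[x ord0] = dot x x.
Proof.
rewrite /q dotE raddf_sum; apply: eq_bigr => k _ /=.
by rewrite rmorphXn /= mevalXU expr2.
Qed.
End Dot.

(** * Moments of an isotropic family *)

(** The right-hand side is, up to scale, the only symmetric 4-linear form
    invariant under the orthogonal group. *)
Definition isotropic4 (K : comNzRingType) (n N : nat) (c : K)
    (a : 'I_N -> 'rV[K]_n) : Prop :=
  forall x y z w : 'rV[K]_n,
  \sum_(j < N) dot (a j) x * dot (a j) y * dot (a j) z * dot (a j) w =
  c * (dot x y * dot z w + dot x z * dot y w + dot x w * dot y z).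

(** A symmetric 4-linear form is determined by its diagonal: the sum of the
    eight fourth powers of $x \pm y \pm z \pm w$, each with the product of its
    signs, is 192 times the polarized form
    ($192 = 2^3 \cdot 4!$). *)
Lemma isotropic4_of_quartic (K : numFieldType) (n N : nat) (c : K)
    (a : 'I_N -> 'rV[K]_n) :
  (forall x, \sum_(j < N) dot (a j) x ^+ 4 = 3 * c * dot x x ^+ 2) ->
  isotropic4 c a.
Proof.
move=> H x y z w.
have n0 : (192%:R : K) != 0 by rewrite pnatr_eq0.
apply: (mulfI n0).
transitivity (\sum_(j < N)
  (dot (a j) (x + y + z + w) ^+ 4 - dot (a j) (x + y + z - w) ^+ 4
   - dot (a j) (x + y - z + w) ^+ 4 + dot (a j) (x + y - z - w) ^+ 4
   - dot (a j) (x - y + z + w) ^+ 4 + dot (a j) (x - y + z - w) ^+ 4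
   + dot (a j) (x - y - z + w) ^+ 4 - dot (a j) (x - y - z - w) ^+ 4)).
  by rewrite mulr_sumr; apply: eq_bigr => j _; rewrite !dotDr !dotNr; ring.
rewrite !(big_split, sumrN) /= !H !(dotDr, dotDl, dotNr, dotNl).
rewrite (dotC y x) (dotC z x) (dotC w x) (dotC z y) (dotC w y) (dotC w z).
ring.
Qed.

Section Moments.
Variables (K : numFieldType) (n N : nat) (a : 'I_N -> 'rV[K]_n).
(* This constant is a third of the scalar in front of the square of the
   quadric in the decomposition. *)
Let c : K := n.+1%:R / (2 * n.+2%:R).
Hypothesis iso : isotropic4 c a.

Let n1 : (n.+1%:R : K) != 0. Proof. by rewrite pnatr_eq0. Qed.
Let n2 : (n.+2%:R : K) != 0. Proof. by rewrite pnatr_eq0. Qed.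

Lemma sum_dot_delta : \sum_(k < n) dot (stdvec K k) (stdvec K k) = n%:R :> K.
Proof.
under eq_bigr => k _ do rewrite dot_delta /stdvec mxE !eqxx.
by rewrite sumr_const card_ord.
Qed.

(** Trace of the fourth-moment identity in its last two arguments. *)
Lemma isotropic_moment2 x y :
  \sum_(j < N) dot (a j) (a j) * (dot (a j) x * dot (a j) y) =
  n.+1%:R / 2 * dot x y.
Proof.
transitivity (\sum_(k < n) \sum_(j < N) dot (a j) x * dot (a j) y
   * dot (a j) (stdvec K k) * dot (a j) (stdvec K k)).
  rewrite exchange_big; apply: eq_bigr => j _ /=.
  rewrite -(dot_parseval (a j) (a j)) mulr_suml; apply: eq_bigr => k _.
  ring.
under eq_bigr => k _ do rewrite iso.
transitivity (c * (dot x y * n%:R + dot x y + dot x y)); last first.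
  by rewrite /c; move: n2; rewrite -!natr1 => ?; field.
rewrite -mulr_sumr !big_split /= -mulr_sumr sum_dot_delta.
congr (c * (_ + _ + _)); exact: dot_parseval.
Qed.

(** A second contraction, in the remaining two arguments. *)
Lemma isotropic_moment0 :
  \sum_(j < N) dot (a j) (a j) ^+ 2 = n%:R * n.+1%:R / 2.
Proof.
transitivity (\sum_(k < n) \sum_(j < N) dot (a j) (a j)
   * (dot (a j) (stdvec K k) * dot (a j) (stdvec K k))).
  rewrite exchange_big; apply: eq_bigr => j _ /=.
  by rewrite -mulr_sumr dot_parseval expr2.
under eq_bigr => k _ do rewrite isotropic_moment2.
by rewrite -mulr_sumr sum_dot_delta; field.
Qed.

(** The matrix $P$ of the proof satisfies $P^2 = P$ and has trace
    $n(n+1)/2$ for any number of points; tightness says that this trace is its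
    size. The coefficients of $P$ are those that make idempotence hold: the one
    of $(a_i \cdot a_j)^2$ is forced by the fourth moments, the other solves a
    quadratic equation, of which the chosen root gives
    $P_{ii} = (a_i \cdot a_i)^2$. *)
Lemma tight_gram_sq : N%:R = n%:R * n.+1%:R / 2 :> K -> forall i j,
  n.+2%:R * dot (a i) (a j) ^+ 2 - dot (a i) (a i) * dot (a j) (a j)
  = n.+1%:R * (i == j)%:R.
Proof.
move=> tight i j.
pose P : 'M[K]_N := \matrix_(i, j) ((n.+2%:R * dot (a i) (a j) ^+ 2 -
  dot (a i) (a i) * dot (a j) (a j)) / n.+1%:R).
have PE x y : P x y = (n.+2%:R * dot (a x) (a y) ^+ 2 -
    dot (a x) (a x) * dot (a y) (a y)) / n.+1%:R by rewrite mxE.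
suff P1 : P = 1%:M.
  move/matrixP/(_ i j): P1; rewrite PE mxE => <-.
  by rewrite [RHS]mulrC divfK.
apply: idempotent_full_trace; last first.
  rewrite tight -isotropic_moment0; apply: eq_bigr => k _; rewrite PE.
  by apply: (mulIf n1); rewrite divfK //; ring.
apply/matrixP => x y; rewrite PE mxE.
pose m4 := \sum_k dot (a k) (a x) * dot (a k) (a x) * dot (a k) (a y) * dot (a k) (a y).
pose m2 x := \sum_k dot (a k) (a k) * (dot (a k) (a x) * dot (a k) (a x)).
pose m0 := \sum_k dot (a k) (a k) ^+ 2.
transitivity (n.+1%:R ^- 2 * (n.+2%:R ^+ 2 * m4
  - n.+2%:R * dot (a y) (a y) * m2 x - n.+2%:R * dot (a x) (a x) * m2 y
  + dot (a x) (a x) * dot (a y) (a y) * m0)).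
  rewrite !mulr_sumr -!sumrN -!big_split mulr_sumr /=; apply: eq_bigr => k _.
  by rewrite !PE (dotC (a x) (a k)); field; rewrite nat1r.
have -> : m4 = _ := iso _ _ _ _.
have m2E u : m2 u = _ := isotropic_moment2 _ _.
rewrite !m2E; have -> : m0 = _ := isotropic_moment0.
by rewrite /c; field; rewrite nat1r -natrD !pnatr_eq0.
Qed.
End Moments.

(** * Parity of regular two-graphs *)

Section TwoGraph.
Variables (V : finType) (s : V -> V -> int) (z : int).
Hypothesis s_sym : forall i j, s i j = s j i.
Hypothesis s_diag : forall i, s i i = 0.
Hypothesis s_sign : forall i j, i != j -> s i j = 1 \/ s i j = - 1.
Hypothesis s_reg : forall i j, i != j -> \sum_k s i j * s i k * s j k = z.

Lemma row_dot i j : i != j -> \sum_k s i k * s j k = z * s i j.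
Proof.
move=> ij; rewrite -(s_reg ij) mulr_suml; apply: eq_bigr => k _.
by case: (s_sign ij) => ->; ring.
Qed.

Lemma row_norm i : \sum_k s i k ^+ 2 = #|V|%:Z - 1.
Proof.
rewrite (bigD1 i) //= s_diag expr0n add0r.
rewrite (eq_bigr (fun=> 1)) => [|k ki]; last first.
  by rewrite eq_sym in ki; case: (s_sign ki) => ->.
have : (0 < #|V|)%N by apply/card_gt0P; exists i.
rewrite sumr_const cardC1 natz; move: #|V| => N N0.
lia.
Qed.

(** Expand $\sum_l (s_{il} + s_{jl})(s_{il} + s_{kl})$. For $l$ outside
    $\{i, j, k\}$ both factors are even, so modulo 4 only three terms remain;
    on the other hand the regularity hypothesis evaluates the whole sum. *)
Lemma triple_mod4 i j k : i != j -> i != k -> j != k ->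
  exists w : int, #|V|%:Z - 1 + z * (s i j + s i k + s j k) =
    2 + s i j * s i k + s i j * s j k + s i k * s j k + 4 * w.
Proof.
move=> ij ik jk.
have -> : #|V|%:Z - 1 + z * (s i j + s i k + s j k) =
    \sum_l (s i l + s j l) * (s i l + s k l).
  rewrite -(row_norm i) !mulrDr -!row_dot // -!big_split.
  by apply: eq_bigr => l _ /=; ring.
rewrite (bigD1 i) //= (bigD1 j) 1?eq_sym //= (bigD1 k) /=; last first.
  by rewrite !(eq_sym k) ik jk.
have dvd l : (l != i) && (l != j) && (l != k) ->
    (4 %| (s i l + s j l) * (s i l + s k l))%Z.
  rewrite !(eq_sym l) => /andP[/andP[li lj] lk].
  have := s_sign li; have := s_sign lj; have := s_sign lk.
  by move=> [] -> [] -> [] ->.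
have [w ->] : exists w : int, \sum_(l | (l != i) && (l != j) && (l != k))
    (s i l + s j l) * (s i l + s k l) = w * 4.
  by apply/dvdzP; apply: rpred_sum.
exists w; rewrite !s_diag (s_sym j i) (s_sym k i) (s_sym k j).
by case: (s_sign ij) (s_sign ik) (s_sign jk) => -> [] -> [] ->; ring.
Qed.

(** If no triple through the pair had sign $e$, all $|V| - 2$ of them would
    have sign $-e$, which fixes the value of $z$. *)
Lemma triple_of_sign (e : int) i j : e = 1 \/ e = - 1 -> i != j ->
  z != - e * (#|V|%:Z - 2) ->
  exists k, [/\ i != k, j != k & s i j * s i k * s j k = e].
Proof.
move=> e_sign ij zne.
have [/existsP[k /and3P[ik jk /eqP E]]|/existsPn none] :=
  boolP [exists k, [&& i != k, j != k & s i j * s i k * s j k == e]].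
  by exists k.
case/eqP: zne; rewrite -(s_reg ij).
(* The squares make the identity hold at $k = i$; the Kronecker term corrects
   it at $k = j$. *)
transitivity (\sum_k (- e * s i k ^+ 2 + e * (k == j)%:R)).
  apply: eq_bigr => k _; have := none k.
  case: (eqVneq i k) => [<-|ik]; first by rewrite s_diag (negPf ij) => _ /=; ring.
  rewrite (eq_sym k).
  case: (eqVneq j k) => [<-|jk]; first by rewrite s_diag; case: (s_sign ij) => -> _ /=; ring.
  by case: (s_sign ij) (s_sign ik) (s_sign jk) e_sign => -> [] -> [] -> [] ->.
rewrite big_split /= -!mulr_sumr row_norm (bigD1 j) //= eqxx big1 => [|k /negPf-> //] /=.
ring.
Qed.

(** By [triple_mod4] a triple of sign 1 gives $z \equiv |V| - 2$ and a triple of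
    sign -1 gives $z \equiv 2 - |V|$ modulo 4. When both kinds occur, 4 divides
    $2(|V| - 2)$. *)
Lemma regular_two_graph_even : (1 < #|V|)%N ->
  z != #|V|%:Z - 2 -> z != - (#|V|%:Z - 2) -> ~~ odd #|V|.
Proof.
move=> /card_gt1P[i [j [_ _ ij]]] zV zNV.
have [|k [ik jk pos]] := @triple_of_sign 1 i j (or_introl erefl) ij.
  by rewrite mulN1r.
have [|l [il jl neg]] := @triple_of_sign (- 1) i j (or_intror erefl) ij.
  by rewrite opprK mul1r.
have [w] := triple_mod4 ij ik jk; have [w'] := triple_mod4 ij il jl.
move: pos neg.
case: (s_sign ij) (s_sign ik) (s_sign jk) (s_sign il) (s_sign jl)
  => -> [] -> [] -> [] -> [] -> //; lia.
Qed.
End TwoGraph.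

(** * Normalization and the sign matrix *)

Lemma isotropic4_scale (K : comNzRingType) (n N : nat) (c : K)
    (a : 'I_N -> 'rV[K]_n) (u : 'I_N -> K) :
  (forall j, u j ^+ 4 = 1) -> isotropic4 c a ->
  isotropic4 c (fun j => u j *: a j).
Proof.
move=> u4 iso x y z w; rewrite -iso; apply: eq_bigr => j _.
rewrite !dotZl -[RHS]mul1r -(u4 j); ring.
Qed.

(** Where $a_j \cdot a_j = -1$ the vector is multiplied by the imaginary unit,
    a fourth root of unity whose square is -1. *)
Lemma isotropic4_normalise (K : numClosedFieldType) (n N : nat) (c : K)
    (a : 'I_N -> 'rV[K]_n) :
  (forall j, dot (a j) (a j) ^+ 2 = 1) -> isotropic4 c a ->
  exists2 b : 'I_N -> 'rV[K]_n,
    isotropic4 c b & forall j, dot (b j) (b j) = 1.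
Proof.
move=> a2 iso; pose u j : K := if dot (a j) (a j) == 1 then 1 else 'i.
exists (fun j => u j *: a j).
  apply: isotropic4_scale iso => j; rewrite /u; case: ifP => _.
    by rewrite expr1n.
  by rewrite (exprM _ 2 2) sqrCi sqrrN expr1n.
move=> j; rewrite dotZl dotZr mulrA /u; case: ifP => [/eqP->|/eqP ne1].
  by rewrite !mulr1.
have /eqP := a2 j; rewrite sqrf_eq1 => /orP[/eqP // | /eqP ->].
by rewrite -expr2 sqrCi mulN1r opprK.
Qed.

(** The signs are $\sqrt{n+2}$ times the off-diagonal Gram entries. The second
    moment says that the Gram matrix $G$ satisfies $G^2 = \frac{n+1}{2} G$;
    removing the diagonal subtracts two terms from each sum of products. *)
Lemma tight_sign_matrix (K : numClosedFieldType) (n N : nat)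
    (b : 'I_N -> 'rV[K]_n) :
  N%:R = n%:R * n.+1%:R / 2 :> K ->
  isotropic4 (n.+1%:R / (2 * n.+2%:R)) b -> (forall j, dot (b j) (b j) = 1) ->
  exists s : 'I_N -> 'I_N -> int,
  [/\ forall i j, s i j = s j i, forall i, s i i = 0,
      forall i j, i != j -> s i j = 1 \/ s i j = - 1 &
      forall i j, i != j -> (\sum_k s i j * s i k * s j k)%:~R =
        sqrtC n.+2%:R * (n%:R - 3) / 2 :> K].
Proof.
move=> tight iso b1; set r := sqrtC _.
have r2 : r ^+ 2 = n.+2%:R by rewrite sqrtCK.
have t2 i j : i != j -> (r * dot (b i) (b j)) ^+ 2 = 1.
  move=> ij; have := tight_gram_sq iso tight i j.
  by rewrite (negPf ij) mulr0 !b1 mulr1 exprMn r2 => /eqP; rewrite subr_eq0 => /eqP.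
pose s i j : int := if i == j then 0 else
  if r * dot (b i) (b j) == 1 then 1 else - 1.
have sE i j : (s i j)%:~R = r * (dot (b i) (b j) - (i == j)%:R).
  rewrite /s; case: eqVneq => [->|ij]; first by rewrite b1 subrr mulr0.
  rewrite subr0; have /eqP := t2 _ _ ij; rewrite sqrf_eq1.
  by case: eqP => [-> //|_ /= /eqP ->]; rewrite mulrN1z.
exists s; split=> [i j|i|i j /negPf ij|i j ij].
- by rewrite /s eq_sym dotC.
- by rewrite /s eqxx.
- by rewrite /s ij; case: ifP; [left|right].
rewrite rmorph_sum /=.
transitivity (r ^+ 3 * dot (b i) (b j) *
  ((n.+1%:R / 2 * dot (b i) (b j)) - dot (b i) (b j) *+ 2)); last first.
  transitivity (r * (r * dot (b i) (b j)) ^+ 2 * (n.+1%:R / 2 - 2)).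
    by field.
  by rewrite t2 //; field.
(* The two terms $k = i$ and $k = j$ of the Gram product, written as a sum
   over $k$ so that the comparison can be made term by term. *)
have two : dot (b i) (b j) *+ 2 =
    \sum_k dot (b i) (b j) * ((i == k)%:R + (j == k)%:R).
  have one u : \sum_k (u == k)%:R = 1 :> K.
    by rewrite (bigD1 u) //= eqxx big1 ?addr0 // => k; rewrite eq_sym => /negPf->.
  by rewrite -mulr_sumr big_split /= !one mulrDr mulr1.
rewrite -(isotropic_moment2 iso (b i) (b j)) two -sumrB mulr_sumr.
apply: eq_bigr => k _; rewrite !rmorphM /= !sE (negPf ij) b1 !(dotC (b k)).
case: (eqVneq i k) => [<-|_]; first by rewrite eq_sym (negPf ij) b1 (dotC (b j)) /=; ring.
by case: (eqVneq j k) => [<-|_]; rewrite ?b1 /=; ring.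
Qed.

(** * Arithmetic of the parameters *)

Lemma tight_arith_square (n : nat) (z : int) : (3 < n)%N ->
  (2 * z) ^+ 2 = (n%:Z + 2) * (n%:Z - 3) ^+ 2 -> exists m, (n + 2 = m ^ 2)%N.
Proof.
move=> n3 E; pose d := (n - 3)%N.
have En : (`|(2 * z)%R| ^ 2 = (n + 2) * d ^ 2)%N.
  apply/eqP; rewrite -eqz_nat -abszX E /d; apply/eqP.
  have -> : n%:Z - 3 = d%:Z by rewrite /d; lia.
  by rewrite /d; lia.
have d0 : (0 < d)%N by rewrite /d; lia.
have /dvdnP[m Em] : (d %| `|(2 * z)%R|)%N.
  by rewrite -(dvdn_pexp2r _ _ (isT : 0 < 2)%N) En dvdn_mull.
exists m; apply/eqP; rewrite -(eqn_pmul2r (_ : 0 < d ^ 2)%N) ?expn_gt0 ?d0 //.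
by rewrite -En Em expnMn.
Qed.

(** Otherwise $(n^2 + n - 4)^2 = (n+2)(n-3)^2$, whose left side is larger. *)
Lemma tight_arith_bound (n N : nat) (z : int) : (3 < n)%N ->
  (N * 2 = n.+1 * n)%N ->
  (2 * z) ^+ 2 = (n%:Z + 2) * (n%:Z - 3) ^+ 2 ->
  z != N%:Z - 2 /\ z != - (N%:Z - 2).
Proof.
move=> n3 EN E.
have : (2 * z) ^+ 2 != (2 * (N%:Z - 2)) ^+ 2.
  rewrite E.
  have -> : 2 * (N%:Z - 2) = (n%:Z + 1) * n%:Z - 4 by lia.
  have [k ->] : exists k : nat, n = (k + 4)%N by exists (n - 4)%N; lia.
  nia.
by move=> ne; split; apply: contraNneq ne => ->; rewrite ?mulrN ?sqrrN.
Qed.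

(** With $m = 2l$ one gets $n = 4l^2 - 2$ and
    $n(n+1)/2 = (2l^2 - 1)(4l^2 - 1)$. *)
Lemma tight_arith_odd (n N m : nat) : (0 < n)%N ->
  (N * 2 = n.+1 * n)%N -> (n + 2 = m ^ 2)%N -> ~~ odd m -> odd N.
Proof.
move=> n0 EN Em m_even.
have [l El] : exists l, m = (2 * l)%N by exists m./2; lia.
have [p Ep] : exists p, n = (4 * p + 2)%N.
  by exists (l ^ 2 - 1)%N; move: Em; rewrite El; nia.
have -> : N = ((2 * p + 1) * (4 * p + 3))%N by move: EN; rewrite Ep; nia.
lia.
Qed.

(** * The theorem *)

Theorem theorem4p27 (R : realType) (n : nat) (hn : (3 <= n)%N)
    (a : 'I_(T2 n) -> 'rV[R[i]]_n) :
  (B2 R[i] n)^-1 *: q R[i] n ^+ 2 = \sum_(j < T2 n) linear_form (a j) ^+ 4 ->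
  n = 3%N \/ exists m : nat, odd m /\ n = (m ^ 2 - 2)%N.
Proof.
move=> H; have [->|n_neq3] := eqVneq n 3%N; [by left | right].
have n3 : (3 < n)%N by rewrite ltn_neqAle eq_sym n_neq3.
have EN : (T2 n * 2 = n.+1 * n)%N.
  by rewrite /T2 addn1 bin2 muln2 halfK oddM /= andNb subn0.
have tight : (T2 n)%:R = n%:R * n.+1%:R / 2 :> R[i].
  apply: (mulIf (_ : 2 != 0 :> R[i])); first by rewrite pnatr_eq0.
  by rewrite divfK ?pnatr_eq0 // -!natrM EN mulnC.
have iso : isotropic4 (n.+1%:R / (2 * n.+2%:R)) a.
  apply: isotropic4_of_quartic => x.
  move/(congr1 (meval (x ord0))): H; rewrite mevalZ rmorphXn /= meval_q.
  rewrite raddf_sum /= => Hx.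
  transitivity (\sum_(j < T2 n) (linear_form (a j) ^+ 4).@[x ord0]).
    by apply: eq_bigr => j _; rewrite rmorphXn /= meval_linear_form.
  rewrite -Hx /B2; congr (_ * _).
  rewrite !natrM invf_div addn1 addn2.
  by field; rewrite -natrD pnatr_eq0.
have a2 j : dot (a j) (a j) ^+ 2 = 1.
  have n1 : (n.+1%:R : R[i]) != 0 by rewrite pnatr_eq0.
  apply: (mulfI n1); rewrite mulr1; have := tight_gram_sq iso tight j j.
  by rewrite eqxx mulr1 => E; rewrite -[RHS]E; ring.
have [b isob b1] := isotropic4_normalise a2 iso.
have [s [s_sym s_diag s_sign s_reg]] := tight_sign_matrix tight isob b1.
have T_gt1 : (1 < #|'I_(T2 n)|)%N by rewrite card_ord; nia.
have /card_gt1P[i [j [_ _ ij]]] := T_gt1.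
pose z := \sum_k s i j * s i k * s j k.
have s_regz u v : u != v -> \sum_k s u v * s u k * s v k = z.
  by move=> uv; apply: (@intr_inj R[i]); rewrite !s_reg.
have Ez : (2 * z) ^+ 2 = (n%:Z + 2) * (n%:Z - 3) ^+ 2.
  apply: (@intr_inj R[i]); rewrite rmorphXn rmorphM /= s_reg //.
  rewrite mulrC divfK ?pnatr_eq0 // exprMn sqrtCK.
  by rewrite rmorphM rmorphXn /= rmorphB rmorphD /= -natrD addn2.
have [m Em] := tight_arith_square n3 Ez.
exists m; split; last by rewrite -Em addnK.
apply/negPn/negP => m_even.
have [zN zNN] := tight_arith_bound n3 EN Ez.
have := regular_two_graph_even s_sym s_diag s_sign s_regz T_gt1.
by rewrite card_ord (tight_arith_odd (ltnW (ltnW hn)) EN Em m_even) => /(_ zN zNN).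
Qed.
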